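(* Let $R$ be a commutative unital ring and let $I$ be a proper ideal of $R$. The following statements are equivalent, and they imply that $\mathrm{V}_R(I)\subseteq \mathrm{Max}(R)$: (1) $I$ is a quasi-maximal ideal of $R$. (2) Every proper ideal of $R/I$ is a quasi-maximal ideal of $R/I$. (3) $0$ is a quasi-maximal ideal of $R/I$. (4) $1\leq \mathrm{L}_R(R/I)\leq 2$ and $|\mathrm{V}_{R/I}(0)|\leq 2$. (5) $\mathcal{O}(R/I)\leq 3$, with $\mathcal{O}(R/I)=3$ if and only if $|\mathrm{Max}(R/I)|=2$. (6) $\mathrm{o}(I)\leq 3$, with $\mathrm{o}(I)=3$ if and only if $|\mathrm{V}_R(I)\cap \mathrm{Max}(R)|=2$. (7) $I\in \mathrm{Q_iMax}(R)\cup \mathrm{Q_rMax}(R)\cup \mathrm{Q_dMax}(R)$.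
   Context: All rings are commutative and unital; $\subset$ denotes proper inclusion. A proper ideal $I$ of $R$ is quasi-maximal if for every $a\in R\setminus I$, either $I+Ra=R$ or $I+Ra$ is a maximal ideal of $R$. An ideal $I$ of $R$ is called: - inert ($I\in\mathrm{Q_iMax}(R)$) if $I\in \mathrm{Max}(R)$; - decomposed ($I\in\mathrm{Q_dMax}(R)$) if $I$ is the intersection of two distinct maximal ideals of $R$; - ramified ($I\in\mathrm{Q_rMax}(R)$) if there is $M\in\mathrm{Max}(R)$ such that $I$ is $M$-primary, $M^2\subseteq I\subset M$, and $M=I+Ra$ for every $a\in M\setminus I$. $\mathrm{V}_R(I)$ is the set of prime ideals of $R$ containing $I$; $\mathrm{Max}(R)$ is the set of maximal ideals; $\mathrm{L}_R(E)$ is the length of an $R$-module $E$. $\mathrm{o}(I)$ is the number of proper ideals of $R$ containing $I$ (including $I$), when finite; $\mathcal{O}(A)$ is the number of proper ideals of a ring $A$ (including $0$), when finite. The statements $\mathcal{O}(R/I)\le 3$ and $\mathrm{o}(I)\leq 3$ include the assertion that these numbers are finite. *)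

(* Defs.v *)
From HB Require Import structures.
From mathcomp Require Import all_boot all_order all_algebra.
From mathcomp Require Export ring_quotient generic_quotient.
From mathcomp Require Import boolp classical_sets cardinality.

Set Implicit Arguments.
Unset Strict Implicit.
Unset Printing Implicit Defensive.

Import GRing.Theory.
Local Open Scope classical_set_scope.
Local Open Scope ring_scope.
Local Open Scope quotient_scope.

Section Ideals.
Variable A : comNzRingType.
Implicit Types (I J M N P Q : set A) (a : A).

(* The predicate [proper_ideal] of ring_quotient does not require stability
   under addition. *)
Definition properIdeal J : Prop := idealr_closed [in J].

(* O(A) is the cardinal of this set. *)
Definition PropIdl : set (set A) := [set J | properIdeal J].

Definition Max : set (set A) :=
  [set M | properIdeal M /\
           forall J, properIdeal J -> M `<=` J -> J = M].

Definition Spec : set (set A) :=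
  [set P | properIdeal P /\ prime_idealr_closed [in P]].

Definition V I : set (set A) := [set P | Spec P /\ I `<=` P].

(* o(I) is the cardinal of this set. *)
Definition PropIdl_above I : set (set A) := [set J | PropIdl J /\ I `<=` J].

(* I + Ra *)
Definition adjoin I a : set A :=
  [set x | exists2 i, I i & exists r, x = i + r * a].

Definition ideal_mul I J : set A :=
  [set z | exists n (x y : 'I_n -> A),
     [/\ forall k, I (x k), forall k, J (y k) & z = \sum_(k < n) x k * y k]].

Definition radical I : set A := [set x | exists n : nat, I (x ^+ n)].

Definition primary Q : Prop :=
  properIdeal Q /\ forall x y, Q (x * y) -> Q x \/ exists n : nat, Q (y ^+ n).

Definition primary_to M Q : Prop := primary Q /\ radical Q = M.

Definition quasi_maximal I : Prop :=
  properIdeal I /\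
  forall a, ~ I a -> adjoin I a = setT \/ Max (adjoin I a).

Definition QiMax : set (set A) := Max.

Definition QdMax : set (set A) :=
  [set I | exists M N, [/\ Max M, Max N, M <> N & I = M `&` N]].

Definition QrMax : set (set A) :=
  [set I | exists2 M, Max M &
     [/\ primary_to M I, ideal_mul M M `<=` I, I `<` M &
         forall a, M a -> ~ I a -> M = adjoin I a]].

(* [idealr A] bundles boolean predicates; classically this loses no ideal. *)
Lemma properIdeal_idealr J :
  properIdeal J -> exists K : idealr A, [set` K] = J.
Proof.
move=> pJ; pose b := isIdealr.Build A [in J] pJ.
pose K : idealr A := HB.pack_for (idealr A) (fun x : A => x \in J) b.
by exists K; apply/seteqP; split=> x /=; rewrite -[x \in K]/(x \in J) inE.
Qed.

End Ideals.

Arguments PropIdl A : clear implicits.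
Arguments Max A : clear implicits.
Arguments Spec A : clear implicits.
Arguments QiMax A : clear implicits.
Arguments QdMax A : clear implicits.
Arguments QrMax A : clear implicits.

Section Length.
Variables (A : pzRingType) (E : lmodType A).

Definition submodule_chain (n : nat) (c : nat -> set E) : Prop :=
  (forall i : nat, (i <= n)%N -> GRing.submod_closed [in c i]) /\
  (forall i : nat, (i < n)%N -> c i `<` c i.+1).

(* The length is the supremum of the lengths of strict chains of submodules;
   a module of infinite length satisfies [has_length n] for no [n]. *)
Definition has_length (n : nat) : Prop :=
  (exists c, submodule_chain n c) /\
  (forall m c, submodule_chain m c -> (m <= n)%N).

End Length.

Arguments has_length A E n : clear implicits.

Section QuotientModule.
Variables (R : comNzRingType) (I : idealr R).

Definition quot_scale (r : R) (x : {ideal_quot I}) : {ideal_quot I} :=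
  \pi_{ideal_quot I} r * x.

Fact quot_scaleA r s x : quot_scale r (quot_scale s x) = quot_scale (r * s) x.
Proof. by rewrite /quot_scale rmorphM mulrA. Qed.

Fact quot_scale1 : left_id 1 quot_scale.
Proof. by move=> x; rewrite /quot_scale rmorph1 mul1r. Qed.

Fact quot_scaleDr : right_distributive quot_scale +%R.
Proof. by move=> r x y; rewrite /quot_scale mulrDr. Qed.

Fact quot_scaleDl x : {morph quot_scale^~ x : r s / r + s}.
Proof. by move=> r s; rewrite /quot_scale rmorphD mulrDl. Qed.

HB.instance Definition _ := GRing.Zmodule_isLmodule.Build R {ideal_quot I}
  quot_scaleA quot_scale1 quot_scaleDr quot_scaleDl.

End QuotientModule.

(* Main.v *)
Require Import Defs.
From mathcomp Require Import all_boot all_order all_algebra.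
From mathcomp Require Import finmap.
From mathcomp Require Import boolp classical_sets cardinality.
From mathcomp Require Import ring.

Local Open Scope classical_set_scope.
Local Open Scope ring_scope.
Local Open Scope card_scope.

Import GRing.Theory.
Set Implicit Arguments.
Unset Strict Implicit.
Unset Printing Implicit Defensive.

(** Call a proper ideal [I] good if each proper ideal containing [I] is [I] or
    maximal. Quasi-maximality says the same: an ideal strictly above [I]
    contains some [I + Ra] with [a] outside [I] ([quasi_maximalP]). The good
    condition depends only on the ordered set of proper ideals above [I], hence
    only on [R/I] ([quasi_maximal_quotient]), and it passes to larger ideals.
    This settles (1), (2) and (3).

    The ideals above a good [I] can be listed ([quasi_maximal_overP]). Two
    distinct maximal ideals [M], [N] above [I] meet in a proper ideal that is
    not maximal, hence is [I]; a third maximal ideal would contain [M `&` N], hence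
    [M] or [N], being prime. So the list is [I], or [I; M], or [I; M; N] with
    [I = M `&` N]. The first list is the inert case, the third the decomposed
    case, and in the second a computation gives [M^2 <= I], which makes [I]
    ramified ([sole_over_QrMax]). The converse from (7) is a comaximality
    argument in each case. The counting conditions can be read off the lists,
    and the three cases show that a prime above [I] is maximal
    ([quasi_maximal_V]).

    Conversely, a proper ideal that is not good has a chain [I < J < K] of
    proper ideals. This contradicts the counting condition (6), as three ideals
    force two maximal ones, different from [I] and [J] ([card_quasi_maximal]);
    condition (5) is (6) for the zero ideal of [R/I]. It contradicts (4) too, as
    the chain continued by [R] makes the length of [R/I] at least [3]
    ([length_quasi_maximal]). *)

(** * Counting by explicit lists *)

Section Cardinality.
Variable T : choiceType.
Implicit Types (X : set T) (s : seq T) (x y z t : T).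

Lemma uniq_seq2 x y : x <> y -> uniq [:: x; y].
Proof. by move=> /eqP xy; rewrite /= inE xy. Qed.

Lemma uniq_seq3 x y z : x <> y -> x <> z -> y <> z -> uniq [:: x; y; z].
Proof.
by move=> /eqP xy /eqP xz /eqP yz; rewrite /= !inE negb_or xy xz yz.
Qed.

Lemma uniq_seq4 x y z t : x <> y -> x <> z -> x <> t -> y <> z -> y <> t ->
  z <> t -> uniq [:: x; y; z; t].
Proof.
move=> /eqP xy /eqP xz /eqP xt yz yt zt.
by rewrite cons_uniq uniq_seq3 // !inE !negb_or xy xz xt.
Qed.

Lemma card_eq_set_seq s : uniq s -> [set` s] #= `I_(size s).
Proof.
move=> us; have -> : [set` s] = [set` [fset x in s]%fset].
  by apply/seteqP; split=> x /=; rewrite inE.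
by apply/card_eq_fsetP; rewrite card_fseq undup_id.
Qed.

Lemma card_le_set_seq s n : (size s <= n)%N -> [set` s] #<= `I_n.
Proof.
move=> sn; have -> : [set` s] = [set` undup s].
  by apply/seteqP; split=> x /=; rewrite mem_undup.
rewrite (card_le_eql (card_eq_set_seq (undup_uniq s))) card_le_II.
exact: leq_trans (size_undup s) sn.
Qed.

Lemma uniq_size_card_le X s n :
  uniq s -> {in s, forall x, X x} -> X #<= `I_n -> (size s <= n)%N.
Proof.
move=> us sX Xn; rewrite -card_le_II -(card_le_eql (card_eq_set_seq us)).
exact: card_le_trans (subset_card_le sX) Xn.
Qed.

Lemma uniq_card_eq X s :
  uniq s -> {in s, forall x, X x} -> X #<= `I_(size s) -> X #= `I_(size s).
Proof.
move=> us sX Xs; rewrite card_eq_le Xs -(card_le_eql (card_eq_set_seq us)).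
exact: subset_card_le.
Qed.

Lemma card_eq2_neq X :
  X #= `I_2 -> exists x y, [/\ X x, X y & x <> y].
Proof.
move=> /eq_cardSP[x Xx] /eq_cardSP[y [Xy yx] _].
by exists x, y; split=> // xy; apply: yx.
Qed.

End Cardinality.

(** * Ideals, maximal ideals and prime ideals *)

Section IdealLattice.
Variable A : comNzRingType.
Implicit Types (I J K M N P : set A) (a x y : A).

(** Ideals, the whole ring included: adjoining an element to a proper ideal
    may give everything, and submodules of a quotient need not be proper. *)
Definition is_ideal J :=
  J 0 /\ forall a u v, J u -> J v -> J (a * u + v).

Lemma properIdealP J : properIdeal J <-> is_ideal J /\ ~ J 1.
Proof.
split=> [[J0 J1 JD]|[[J0 JD] J1]].
  split; last by move=> J1'; case/negP: J1; exact: mem_set.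
  split; first by move: J0; rewrite !inE.
  by move=> a u v Ju Jv; have := JD a u v; rewrite !inE; apply.
split; rewrite ?inE //; first by apply/negP; rewrite inE.
by move=> a u v; rewrite !inE; apply: JD.
Qed.

Lemma is_idealD J x y : is_ideal J -> J x -> J y -> J (x + y).
Proof. by move=> [_ JD] Jx Jy; rewrite -[x]mul1r; apply: JD. Qed.

Lemma is_idealM J a x : is_ideal J -> J x -> J (a * x).
Proof. by move=> [J0 JD] Jx; rewrite -[a * x]addr0; apply: JD. Qed.

Lemma is_idealMr J a x : is_ideal J -> J x -> J (x * a).
Proof. by rewrite mulrC; apply: is_idealM. Qed.

Lemma is_idealB J x y : is_ideal J -> J x -> J y -> J (x - y).
Proof.
by move=> idJ Jx Jy; apply: is_idealD => //; rewrite -mulN1r; apply: is_idealM.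
Qed.

Lemma is_ideal1 J : is_ideal J -> J 1 -> J = setT.
Proof.
move=> idJ J1; apply/seteqP; split=> // x _.
by rewrite -[x]mulr1; apply: is_idealM.
Qed.

Lemma is_ideal_properVT J : is_ideal J -> J = setT \/ properIdeal J.
Proof.
move=> idJ; have [J1|nJ1] := pselect (J 1); first by left; apply: is_ideal1.
by right; apply/properIdealP.
Qed.

Lemma is_ideal0 : is_ideal [set 0 : A].
Proof. by split=> //= a u v -> ->; rewrite mulr0 addr0. Qed.

Lemma properIdeal0 : properIdeal [set 0 : A].
Proof.
apply/properIdealP; split; first exact: is_ideal0.
by apply/eqP; rewrite oner_eq0.
Qed.

Lemma properIdeal_sub0 J : properIdeal J -> [set 0] `<=` J.
Proof. by move=> /properIdealP[[J0 _] _] _ ->. Qed.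

Lemma properIdealI J K : properIdeal J -> properIdeal K -> properIdeal (J `&` K).
Proof.
move=> /properIdealP[[J0 JD] J1] /properIdealP[[K0 KD] _].
apply/properIdealP; split; last by case.
by split=> // a u v [Ju Ku] [Jv Kv]; split; [apply: JD | apply: KD].
Qed.

Lemma sub_adjoin I a : I `<=` adjoin I a.
Proof. by move=> x Ix; exists x => //; exists 0; rewrite mul0r addr0. Qed.

Lemma mem_adjoin I a : is_ideal I -> adjoin I a a.
Proof. by move=> [I0 _]; exists 0 => //; exists 1; rewrite mul1r add0r. Qed.

Lemma adjoin_sub I J a : is_ideal J -> I `<=` J -> J a -> adjoin I a `<=` J.
Proof.
move=> idJ IJ Ja _ [i Ii [r ->]].
by apply: is_idealD => //; [apply: IJ | apply: is_idealM].
Qed.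

Lemma is_ideal_adjoin I a : is_ideal I -> is_ideal (adjoin I a).
Proof.
move=> [I0 ID]; split; first by exists 0 => //; exists 0; rewrite mul0r addr0.
move=> c _ _ [i Ii [r ->]] [j Ij [s ->]]; exists (c * i + j); first exact: ID.
by exists (c * r + s); ring.
Qed.

Lemma Max_proper M : Max A M -> properIdeal M. Proof. by case. Qed.

Lemma Max_ideal M : Max A M -> is_ideal M.
Proof. by move=> /Max_proper/properIdealP[]. Qed.

Lemma Max_sub_eq M N : Max A M -> Max A N -> M `<=` N -> M = N.
Proof. by move=> [_ Mmax] [pN _] MN; rewrite (Mmax N). Qed.

Lemma Max_comaximal M a :
  Max A M -> ~ M a -> exists m r, M m /\ 1 = m + r * a.
Proof.
move=> MM Ma; have idM := Max_ideal MM.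
have [eT|pMa] := is_ideal_properVT (is_ideal_adjoin a idM).
  have : adjoin M a 1 by rewrite eT.
  by move=> [m Mm [r e]]; exists m, r.
case: Ma; rewrite -(MM.2 _ pMa (@sub_adjoin M a)); exact: mem_adjoin.
Qed.

Lemma Max_prime M x y : Max A M -> M (x * y) -> M x \/ M y.
Proof.
move=> MM Mxy; have idM := Max_ideal MM.
have [Mx|nMx] := pselect (M x); [by left | right].
have [m [r [Mm e]]] := Max_comaximal MM nMx.
have -> : y = m * y + r * (x * y) by rewrite -{1}[y]mul1r e; ring.
by apply: is_idealD => //; [apply: is_idealMr | apply: is_idealM].
Qed.

Lemma Max_Spec M : Max A M -> Spec A M.
Proof.
move=> MM; split; first exact: Max_proper.
move=> u v; rewrite !inE => /(Max_prime MM) [Mu|Mv]; apply/orP.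
  by left; rewrite inE.
by right; rewrite inE.
Qed.

Lemma Spec_prime P x y : Spec A P -> P (x * y) -> P x \/ P y.
Proof.
move=> [_ pP] Pxy; have := pP x y; rewrite !inE => /(_ Pxy).
by move=> /orP[]; rewrite inE; [left | right].
Qed.

Lemma Spec_proper P : Spec A P -> properIdeal P. Proof. by case. Qed.

Lemma Spec_expr P x n : Spec A P -> P (x ^+ n) -> P x.
Proof.
move=> SP; have /properIdealP[_ P1] := Spec_proper SP.
elim: n => [|n IHn]; first by rewrite expr0.
by rewrite exprS => /(Spec_prime SP)[].
Qed.

Lemma Spec_setI_sub P M N : is_ideal M -> is_ideal N -> Spec A P ->
  M `&` N `<=` P -> M `<=` P \/ N `<=` P.
Proof.
move=> idM idN SP MNP.
have [|/existsNP[m /not_implyP[Mm nPm]]] := pselect (M `<=` P).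
  by left.
right=> n Nn; have /(Spec_prime SP)[]// : P (m * n).
by apply: MNP; split; [apply: is_idealMr | apply: is_idealM].
Qed.

(** * Quasi-maximal ideals and the ideals above them *)

(** The workhorse: an ideal [J] strictly above a quasi-maximal [I] contains
    some [I + Ra] with [a] outside [I]; as that is maximal, [J] equals it. *)
Lemma quasi_maximalP I :
  quasi_maximal I <->
  properIdeal I /\ forall J, properIdeal J -> I `<=` J -> J = I \/ Max A J.
Proof.
split=> [[pI qI]|[pI hI]].
  split=> // J pJ IJ; have /properIdealP[idJ J1] := pJ.
  have [JI|/existsNP[a /not_implyP[Ja nIa]]] := pselect (J `<=` I).
    by left; apply/seteqP.
  have sJ := adjoin_sub idJ IJ Ja.
  have [eT|MIa] := qI a nIa; first by case: J1; apply: sJ; rewrite eT.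
  by right; rewrite (MIa.2 J pJ sJ).
split=> // a nIa; have /properIdealP[idI _] := pI.
have [|pIa] := is_ideal_properVT (is_ideal_adjoin a idI); first by left.
have [eI|] := hI _ pIa (@sub_adjoin I a); last by right.
by case: nIa; rewrite -eI; apply: mem_adjoin.
Qed.

Lemma quasi_maximal_proper I : quasi_maximal I -> properIdeal I.
Proof. by case. Qed.

Lemma quasi_maximal_over I J :
  quasi_maximal I -> properIdeal J -> I `<=` J -> quasi_maximal J.
Proof.
move=> /quasi_maximalP[_ hI] pJ IJ; apply/quasi_maximalP; split=> // K pK JK.
have [eKI|] := hI K pK (subset_trans IJ JK); last by right.
by left; apply/seteqP; split=> //; rewrite eKI.
Qed.

Lemma ex_overMax I : quasi_maximal I -> ~ Max A I ->
  exists2 M, Max A M & I `<=` M.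
Proof.
move=> /quasi_maximalP[pI hI] nMI.
have /existsNP[J /not_implyP[pJ /not_implyP[IJ nJI]]] :
  ~ forall J, properIdeal J -> I `<=` J -> J = I by move=> h; apply: nMI.
by exists J => //; case: (hI J pJ IJ).
Qed.

(** Two distinct maximal ideals meet in a proper ideal that is not maximal,
    which leaves only [I] when [I] is quasi-maximal and lies in both. *)
Lemma quasi_maximal_setI I M N : quasi_maximal I ->
  Max A M -> Max A N -> M <> N -> I `<=` M -> I `<=` N -> I = M `&` N.
Proof.
move=> /quasi_maximalP[_ hI] MM MN neMN IM IN.
have [//|MMN] : M `&` N = I \/ Max A (M `&` N).
  by apply: hI; [apply: properIdealI; apply: Max_proper | rewrite subsetI].
case: neMN; rewrite -(Max_sub_eq MMN MM (@subIsetl _ _ _)).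
exact: Max_sub_eq MMN MN (@subIsetr _ _ _).
Qed.

(** The ideals above are listed as sequences so that cardinals can be read off
    and membership tested; [~ Max A I] keeps the lists free of duplicates. *)
Variant over_spec I : Prop :=
| OverInert of Max A I & PropIdl_above I = [set` [:: I]]
| OverRamified M of ~ Max A I & Max A M & PropIdl_above I = [set` [:: I; M]]
| OverDecomposed M N of ~ Max A I & Max A M & Max A N & M <> N &
    I = M `&` N & PropIdl_above I = [set` [:: I; M; N]].

(** A maximal ideal [J] besides [M] and [N] cannot occur in the last case: it
    would contain [M `&` N = I], and so [M] or [N] by primality. *)
Lemma quasi_maximal_overP I : quasi_maximal I -> over_spec I.
Proof.
move=> qI; have /quasi_maximalP[pI hI] := qI.
have [MI|nMI] := pselect (Max A I).
  apply: OverInert => //; apply/seteqP; split=> J /=; rewrite inE.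
    by move=> [pJ IJ]; apply/eqP; apply: MI.2.
  by move=> /eqP->; split.
have [M MM IM] := ex_overMax qI nMI.
have [[N [MN IN neMN]]|nN] := pselect (exists N, [/\ Max A N, I `<=` N & M <> N]).
  have eI := quasi_maximal_setI qI MM MN neMN IM IN.
  apply: (@OverDecomposed I M N) => //; apply/seteqP; split=> J /=; rewrite !inE.
    move=> [pJ IJ]; have [->|MJ] := hI J pJ IJ; first by rewrite eqxx.
    have IJ' := IJ; rewrite eI in IJ'.
    have [sMJ|sNJ] := Spec_setI_sub (Max_ideal MM) (Max_ideal MN) (Max_Spec MJ) IJ'.
      by rewrite (Max_sub_eq MM MJ sMJ) eqxx orbT.
    by rewrite (Max_sub_eq MN MJ sNJ) eqxx !orbT.
  by move=> /or3P[]/eqP->; split=> //; apply: Max_proper.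
apply: (@OverRamified I M) => //; apply/seteqP; split=> J /=; rewrite !inE.
  move=> [pJ IJ]; have [->|MJ] := hI J pJ IJ; first by rewrite eqxx.
  have [->|nMJ] := pselect (M = J); first by rewrite eqxx orbT.
  by case: nN; exists J.
by move=> /orP[]/eqP->; split=> //; apply: Max_proper.
Qed.

(** * Counting the ideals above a quasi-maximal ideal *)

Lemma V_MaxE I : V I `&` Max A = PropIdl_above I `&` Max A.
Proof.
apply/seteqP; split=> P [[sP IP] MP]; split=> //; split=> //.
  exact: Max_proper.
exact: Max_Spec.
Qed.

(** The only proper ideals above a quasi-maximal one besides itself are
    maximal, so [3] ideals means two maximal ones and their intersection. *)
Lemma quasi_maximal_card I : quasi_maximal I ->
  PropIdl_above I #<= `I_3 /\
  (PropIdl_above I #= `I_3 <-> V I `&` Max A #= `I_2).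
Proof.
move=> qI; rewrite V_MaxE.
suff [s [us sz sE [t [ut tE st]]]] : exists s : seq (set A),
    [/\ uniq s, (size s <= 3)%N, PropIdl_above I = [set` s] &
    exists t : seq (set A), [/\ uniq t, PropIdl_above I `&` Max A = [set` t] &
    (size s = 3) <-> (size t = 2)]].
  rewrite sE; split; first exact: card_le_set_seq.
  rewrite -sE tE sE.
  rewrite (card_eql (card_eq_set_seq us)) (card_eql (card_eq_set_seq ut)).
  by split=> /card_eq_II /st /card_eq_II.
have [MI|M nMI MM|M N nMI MM MN neMN _] := quasi_maximal_overP qI => eI.
all: rewrite eI.
- exists [:: I]; split=> //; exists [:: I]; split=> //.
  apply/seteqP; split=> J /=; rewrite inE; first by case.
  by move=> /eqP->; rewrite eqxx.
- have neIM : I <> M by move=> e; apply: nMI; rewrite e.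
  exists [:: I; M]; split=> //; first exact: uniq_seq2.
  exists [:: M]; split=> //.
  apply/seteqP; split=> J /=; rewrite !inE; last by move=> ->; rewrite eqxx orbT.
  by move=> [/orP[]/eqP->].
have neIM : I <> M by move=> e; apply: nMI; rewrite e.
have neIN : I <> N by move=> e; apply: nMI; rewrite e.
exists [:: I; M; N]; split=> //; first exact: uniq_seq3.
exists [:: M; N]; split=> //; first exact: uniq_seq2.
apply/seteqP; split=> J /=; rewrite !inE.
  by move=> [/or3P[]/eqP->]; rewrite ?eqxx ?orbT.
by move=> /orP[]/eqP->; rewrite eqxx ?orbT.
Qed.

(** Proper ideals [I < J < K] would use up the three allowed ideals, which
    forces two maximal ideals above [I]; these differ from each other, from [I]
    and from [J], so there would be four ideals. *)
Lemma card_quasi_maximal I : properIdeal I ->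
  PropIdl_above I #<= `I_3 ->
  (PropIdl_above I #= `I_3 <-> V I `&` Max A #= `I_2) ->
  quasi_maximal I.
Proof.
move=> pI le3 eq3; apply/quasi_maximalP; split=> // J pJ IJ.
have [->|neJI] := pselect (J = I); first by left.
right; split=> // K pK JK; apply: contrapT => neKJ.
have IK := subset_trans IJ JK.
have neIJ : I <> J by move=> e; apply: neJI.
have neJK : J <> K by move=> e; apply: neKJ.
have neIK : I <> K by move=> e; apply: neJI; apply/seteqP; split=> //; rewrite e.
have /eq3 : PropIdl_above I #= `I_3.
  apply: (@uniq_card_eq _ _ [:: I; J; K]) => //; first exact: uniq_seq3.
  by move=> L; rewrite !inE => /or3P[]/eqP->; split.
rewrite V_MaxE => /card_eq2_neq[M [N [[aM MM] [aN MN] neMN]]].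
have neMax P : Max A P -> I <> P /\ J <> P.
  move=> MP; split=> e; rewrite -{}e in MP; first by apply: neJI; apply: MP.2.
  by apply: neKJ; apply: MP.2.
have [IM JM] := neMax M MM; have [IN JN] := neMax N MN.
have : (size [:: I; J; M; N] <= 3)%N; last by [].
apply: uniq_size_card_le le3; first exact: uniq_seq4.
by move=> P; rewrite !inE => /or4P[]/eqP-> //; split.
Qed.

(** * The inert, ramified and decomposed cases *)

(** [M^2] lies in [I]: if [ab] did not, [M = I + Rab] would give
    [a (1 - rb)] in [I] for some [r], while [1 - rb] is outside [M], so that
    [I + R(1 - rb)] is the whole ring and [a] would lie in [I]. *)
Lemma sole_over_QrMax I M : properIdeal I -> ~ Max A I -> Max A M ->
  PropIdl_above I = [set` [:: I; M]] -> QrMax A I.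
Proof.
move=> pI nMI MM eI; have /properIdealP[idI I1] := pI.
have idM := Max_ideal MM; have /properIdealP[_ M1] := Max_proper MM.
have over J : properIdeal J -> I `<=` J -> J = I \/ J = M.
  move=> pJ IJ; have : PropIdl_above I J by [].
  by rewrite eI /= !inE => /orP[]/eqP->; [left|right].
have [_ IM] : PropIdl_above I M by rewrite eI /= !inE eqxx orbT.
have adjM a : M a -> ~ I a -> M = adjoin I a.
  move=> Ma nIa; have sM := adjoin_sub idM IM Ma.
  have [||e|->//] := over (adjoin I a).
  - by apply/properIdealP; split; [apply: is_ideal_adjoin | move=> /sM].
  - exact: sub_adjoin.
  by case: nIa; rewrite -e; apply: mem_adjoin.
have adjT a : ~ M a -> exists i r, I i /\ 1 = i + r * a.
  move=> nMa; have [eT|p] := is_ideal_properVT (is_ideal_adjoin a idI).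
    have : adjoin I a 1 by rewrite eT.
    by move=> [i Ii [r e]]; exists i, r.
  have aa := mem_adjoin a idI.
  have [e|e] := over _ p (@sub_adjoin I a); last by case: nMa; rewrite -e.
  by case: nMa; apply: IM; rewrite -e.
have sq a b : M a -> M b -> I (a * b).
  move=> Ma Mb; apply: contrapT => nIab.
  have := Ma; rewrite {1}(adjM (a * b)) //; last exact: is_idealM.
  (* Now [a = i + rab], so [a (1 - rb) = i] lies in [I]. *)
  move=> [i Ii [r e]].
  have [|j [s [Ij e']]] := adjT (1 - r * b).
    move=> h; apply: M1; rewrite -(subrK (r * b) 1).
    by apply: is_idealD => //; apply: is_idealM.
  apply: nIab; apply: is_idealMr => //.
  have -> : a = a * j + s * i.
    have ei : i = a - r * (a * b) by rewrite {1}e; ring.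
    by rewrite -{1}[a]mulr1 e' ei; ring.
  by apply: is_idealD => //; apply: is_idealM.
have radM : radical I = M.
  apply/seteqP; split=> x; first by move=> [n /IM]; apply: Spec_expr (Max_Spec MM).
  by move=> Mx; exists 2%N; rewrite expr2; apply: sq.
exists M => //; split=> //.
- split=> //; split=> // x y Ixy.
  have [My|nMy] := pselect (M y).
    by right; exists 2%N; rewrite expr2; apply: sq.
  left; have [i [r [Ii e]]] := adjT y nMy.
  have -> : x = x * i + r * (x * y) by rewrite -{1}[x]mulr1 e; ring.
  by apply: is_idealD => //; apply: is_idealM.
- move=> _ [n [x [y [Mx My ->]]]]; elim/big_ind: _.
  + by case: idI.
  + by move=> u v; apply: is_idealD.
  + by move=> k _; apply: sq.
split=> // MI; apply: nMI.
by have -> : I = M by apply/seteqP.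
Qed.

Lemma quasi_maximal_trichotomy I :
  quasi_maximal I -> (QiMax A `|` QrMax A `|` QdMax A) I.
Proof.
move=> qI; have pI := quasi_maximal_proper qI.
have [MI _|M nMI MM eI|M N _ MM MN neMN eI _] := quasi_maximal_overP qI.
- by left; left.
- by left; right; apply: sole_over_QrMax eI.
by right; exists M, N.
Qed.

Lemma QiMax_quasi_maximal I : QiMax A I -> quasi_maximal I.
Proof.
move=> MI; apply/quasi_maximalP; split; first exact: Max_proper.
by move=> J pJ IJ; left; apply: MI.2.
Qed.

Lemma QdMax_quasi_maximal I : QdMax A I -> quasi_maximal I.
Proof.
move=> [M [N [MM MN neMN eI]]]; apply/quasi_maximalP.
have pI : properIdeal I by rewrite eI; apply: properIdealI; apply: Max_proper.
split=> // J pJ IJ; have /properIdealP[idJ J1] := pJ.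
have idM := Max_ideal MM; have idN := Max_ideal MN.
(* If [a] in [J] is outside [P], then [1 = m + ra] with [m] in [P], and every
   [n] in [Q] is the sum of [mn], which lies in [I], and a multiple of [a]. *)
have half P Q : Max A P -> Max A Q -> I = P `&` Q -> J `<=` Q ->
    ~ J `<=` P -> J = Q.
  move=> MP MQ eI' JQ /existsNP[a /not_implyP[Ja nPa]].
  apply/seteqP; split=> // n Qn.
  have [m [r [Pm e]]] := Max_comaximal MP nPa.
  have -> : n = m * n + (n * r) * a by rewrite -{1}[n]mul1r e; ring.
  apply: is_idealD => //; last exact: is_idealM.
  apply: IJ; rewrite eI'; split; last by apply: is_idealM => //; apply: Max_ideal.
  by apply: is_idealMr => //; apply: Max_ideal.
have [JM|JM] := pselect (J `<=` M); have [JN|JN] := pselect (J `<=` N).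
- by left; apply/seteqP; split=> //; rewrite eI subsetI.
- by right; rewrite (half N M) // setIC.
- by right; rewrite (half M N).
case: J1; move: JM => /existsNP[a /not_implyP[Ja nMa]].
move: JN => /existsNP[b /not_implyP[Jb nNb]].
have [m [r [Mm e]]] := Max_comaximal MM nMa.
have [n [s [Nn e']]] := Max_comaximal MN nNb.
(* [1 = mn + msb + ra], where [mn] lies in [M `&` N = I]. *)
have -> : 1 = m * n + ((m * s) * b + r * a) by rewrite {1}e -{1}[m]mulr1 e'; ring.
apply: is_idealD => //; last by apply: is_idealD => //; apply: is_idealM.
by apply: IJ; rewrite eI; split; [apply: is_idealMr | apply: is_idealM].
Qed.

Lemma QrMax_quasi_maximal I : QrMax A I -> quasi_maximal I.
Proof.
move=> [M MM [[[pI _] _] sqM [IM _] adjM]]; split=> // a nIa.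
have [Ma|nMa] := pselect (M a); [by right; rewrite -adjM | left].
have /properIdealP[idI _] := pI.
have idIa := is_ideal_adjoin a idI.
apply: is_ideal1 => //; have [m [r [Mm e]]] := Max_comaximal MM nMa.
(* Squaring [1 = m + ra] moves the first term into [I]. *)
exists (m * m).
  apply: sqM; exists 1%N, (fun=> m), (fun=> m).
  by split=> //; rewrite big_ord1.
exists (m * r + r).
have -> : m * m + (m * r + r) * a = m * (m + r * a) + r * a by ring.
by rewrite -e mulr1.
Qed.

Lemma trichotomy_quasi_maximal I :
  (QiMax A `|` QrMax A `|` QdMax A) I -> quasi_maximal I.
Proof.
by case=> [[]|]; [apply: QiMax_quasi_maximal | apply: QrMax_quasi_maximal |
  apply: QdMax_quasi_maximal].
Qed.

(** A prime above [I] that is not maximal has to be [I]; but a prime ideal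
    is neither ramified, since it equals its radical, nor decomposed, since it
    cannot be an intersection of two ideals properly containing it. *)
Lemma quasi_maximal_V I : quasi_maximal I -> V I `<=` Max A.
Proof.
move=> qI P [SP IP]; have /quasi_maximalP[_ hI] := qI.
have [eP|//] := hI P (Spec_proper SP) IP; subst P.
have [[//|[M MM [[_ radI] _ _ _]]]|[M [N [MM MN _ eI]]]] :=
  quasi_maximal_trichotomy qI.
  have -> // : I = M; rewrite -radI; apply/seteqP; split=> x.
    by move=> Ix; exists 1%N.
  by move=> [n]; apply: Spec_expr.
have MNI : M `&` N `<=` I by rewrite eI.
have IMN : I `<=` M `&` N by rewrite -eI.
have [IM IN] : I `<=` M /\ I `<=` N by rewrite -subsetI.
have [MI|NI] := Spec_setI_sub (Max_ideal MM) (Max_ideal MN) SP MNI.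
  by have -> : I = M by apply/seteqP.
by have -> : I = N by apply/seteqP.
Qed.

Lemma quasi_maximal_card_V I : quasi_maximal I -> V I #<= `I_2.
Proof.
move=> qI; have sV := quasi_maximal_V qI.
have sVM : V I `<=` PropIdl_above I `&` Max A.
  by rewrite -V_MaxE => P VP; split=> //; apply: sV.
suff [s sz sE] : exists2 s : seq (set A), (size s <= 2)%N & V I `<=` [set` s].
  exact: card_le_trans (subset_card_le sE) (card_le_set_seq sz).
have [MI|M nMI MM|M N nMI MM MN neMN _] := quasi_maximal_overP qI => eI.
- by exists [:: I] => // P /sVM[]; rewrite eI.
- by exists [:: I; M] => // P /sVM[]; rewrite eI.
exists [:: M; N] => // P /sVM[]; rewrite eI /= !inE => /or3P[]/eqP-> //.
  by rewrite eqxx.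
by rewrite eqxx orbT.
Qed.

End IdealLattice.

(** * Length *)

Section Length.
Variables (A : pzRingType) (E : lmodType A).

Lemma ex_has_length k N c : submodule_chain (E := E) k c ->
  (forall m c', submodule_chain (E := E) m c' -> (m <= N)%N) ->
  exists2 n, has_length A E n & (k <= n <= N)%N.
Proof.
move=> ck bN; pose P m := `[< exists c', submodule_chain (E := E) m c' >].
have exP : exists m, P m by exists k; apply/asboolP; exists c.
have bP m : P m -> (m <= N)%N by move=> /asboolP[c' /bN].
have [n /asboolP[c' cn] maxn] := ex_maxnP exP bP.
exists n; last by rewrite (bN n c') // andbT; apply: maxn; apply/asboolP; exists c.
split; first by exists c'.
by move=> m d dm; apply: maxn; apply/asboolP; exists d.
Qed.

End Length.

(** * The quotient ring *)

Section Quotient.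
Variables (R : comNzRingType) (I : idealr R).
Local Notation Q := {ideal_quot I}.
Local Notation pi := (\pi_{ideal_quot I}%qT : R -> Q).
Implicit Types (J K : set Q) (L : set R).

(** Every element of [R/I] is the class of some [repr a], so stability under
    scaling by [R] is stability under multiplication by [R/I]. *)
Lemma submod_closed_ideal J : GRing.submod_closed [in J] <-> is_ideal J.
Proof.
split=> [[J0 JD]|[J0 JD]].
  split; first by move: J0; rewrite inE.
  move=> a u v Ju Jv; have := JD (repr a) u v; rewrite !inE => /(_ Ju Jv).
  have -> // : repr a *: u = a * u.
  by rewrite -[repr a *: u]/(pi (repr a) * u) reprK.
split; first by rewrite inE.
by move=> r u v; rewrite !inE; apply: JD.
Qed.

Lemma mem_quotient_ideal x : I x <-> pi x = 0.
Proof.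
rewrite -[I x]/(x \in I) -{1}[x]subr0 Quotient.idealrBE.
have <- : pi 0 = 0 by rewrite rmorph0.
by split=> [/eqP|->].
Qed.

Lemma preimage_ideal J : is_ideal (pi @^-1` J) <-> is_ideal J.
Proof.
split=> [[J0 JD]|[J0 JD]].
  split; first by move: J0; rewrite /= rmorph0.
  move=> a u v Ju Jv; have := JD (repr a) (repr u) (repr v).
  by rewrite /= rmorphD rmorphM /= !reprK; apply.
split; first by rewrite /= rmorph0.
by move=> a u v Ju Jv; rewrite /= rmorphD rmorphM; apply: JD.
Qed.

Lemma preimage_properIdeal J : properIdeal (pi @^-1` J) <-> properIdeal J.
Proof.
by split=> /properIdealP[/preimage_ideal idJ J1]; apply/properIdealP; split=> //;
  move: J1; rewrite /= rmorph1.
Qed.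

Lemma preimage_subset J K : pi @^-1` J `<=` pi @^-1` K <-> J `<=` K.
Proof.
split=> JK x; last exact: JK.
by rewrite -[x]reprK; apply: JK.
Qed.

Lemma preimage_inj J K : pi @^-1` J = pi @^-1` K -> J = K.
Proof. by move=> e; apply/seteqP; split; apply/preimage_subset; rewrite e. Qed.

Lemma preimage0 : pi @^-1` [set 0] = [set` I].
Proof. by apply/seteqP; split=> x /mem_quotient_ideal. Qed.

Lemma sub_preimage J : properIdeal J -> [set` I] `<=` pi @^-1` J.
Proof.
by move=> pJ; rewrite -preimage0; apply/preimage_subset; apply: properIdeal_sub0.
Qed.

(** [repr (pi x)] differs from [x] by an element of [I], so for [L] above [I]
    membership in [L] can be tested on representatives. *)
Lemma properIdeal_preimage L : properIdeal L -> [set` I] `<=` L ->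
  exists2 J, properIdeal J & L = pi @^-1` J.
Proof.
move=> pL IL; have /properIdealP[idL _] := pL.
have eL : L = pi @^-1` [set q | L (repr q)].
  have IB x : L (repr (pi x) - x).
    by apply: IL; apply/mem_quotient_ideal; rewrite rmorphB /= reprK subrr.
  apply/seteqP; split=> x /= Lx.
    by rewrite -(subrK x (repr _)); apply: is_idealD.
  by rewrite -(subKr (repr (pi x)) x); apply: is_idealB.
by exists [set q | L (repr q)] => //; apply/preimage_properIdeal; rewrite -eL.
Qed.

Lemma preimage_Max J : Max R (pi @^-1` J) <-> Max Q J.
Proof.
split=> [[/preimage_properIdeal pJ maxJ]|[pJ maxJ]].
  split=> // K pK JK; apply: preimage_inj.
  by apply: maxJ; [apply/preimage_properIdeal | apply/preimage_subset].
split=> [|L pL JL]; first exact/preimage_properIdeal.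
have [K pK eL] := properIdeal_preimage pL (subset_trans (sub_preimage pJ) JL).
by rewrite eL (maxJ K) //; apply/preimage_subset; rewrite -eL.
Qed.

Lemma quasi_maximal_quotient :
  quasi_maximal [set 0 : Q] <-> quasi_maximal [set` I].
Proof.
split=> /quasi_maximalP[p0 h]; apply/quasi_maximalP; split.
- by rewrite -preimage0; apply/preimage_properIdeal.
- move=> L pL IL; have [J pJ ->] := properIdeal_preimage pL IL.
  have [->|MJ] := h J pJ (properIdeal_sub0 pJ); first by left; rewrite preimage0.
  by right; apply/preimage_Max.
- exact: properIdeal0.
move=> J pJ _; have pJ' : properIdeal (pi @^-1` J) by apply/preimage_properIdeal.
have [e|/preimage_Max] := h _ pJ' (sub_preimage pJ); last by right.
by left; apply: preimage_inj; rewrite preimage0.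
Qed.

(** A nonzero proper ideal [J] that is not maximal gives a chain
    [0 < J < K < R/I] of length [3]. Conversely, in a chain of that length the
    second term is nonzero and proper, but the third shows it is not maximal. *)
Lemma length_quasi_maximal :
  (exists2 n, has_length R Q n & (1 <= n <= 2)%N) <->
  quasi_maximal [set 0 : Q].
Proof.
have ltT J : properIdeal J -> J `<` setT.
  by move=> /properIdealP[_ J1]; split=> // TJ; apply: J1; apply: TJ.
split=> [[n [_ bn] /andP[_ n2]]|qm0].
  apply/quasi_maximalP; split; first exact: properIdeal0.
  move=> J pJ _; have [->|neJ0] := pselect (J = [set 0]); [by left | right].
  split=> // K pK JK; apply: contrapT => neKJ.
  have : (3 <= 2)%N; last by [].
  (* Past the end of the list, [nth] returns the default value [setT]. *)
  apply: leq_trans n2; apply: (bn _ (nth setT [:: [set 0]; J; K])); split.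
    move=> i _; apply/submod_closed_ideal; case: i => [|[|[|i]]] /=.
    + exact: is_ideal0.
    + by case/properIdealP: pJ.
    + by case/properIdealP: pK.
    by rewrite nth_nil.
  case=> [|[|[|//]]] _ /=; last exact: ltT.
    split; first exact: properIdeal_sub0.
    by move=> J0; apply: neJ0; apply/seteqP; split=> //; apply: properIdeal_sub0.
  by split=> // KJ; apply: neKJ; apply/seteqP.
apply: (ex_has_length (c := nth setT [:: [set 0]])).
  split=> [i _|[|//] _]; last exact/ltT/properIdeal0.
  apply/submod_closed_ideal; case: i => [|i]; first exact: is_ideal0.
  by rewrite /= nth_nil.
move=> m c [idc ltc]; rewrite leqNgt; apply/negP => m2.
have c_ideal i : (i <= m)%N -> is_ideal (c i).
  by move=> im; apply/submod_closed_ideal/idc.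
have [c0 c1 c2] : [/\ c 0 `<` c 1, c 1 `<` c 2 & c 2 `<` c 3]%N.
  by split; apply: ltc => //; apply: ltn_trans m2.
have p2 : properIdeal (c 2).
  have [e|//] := is_ideal_properVT (c_ideal 2 (ltnW m2)).
  by case: c2 => _; rewrite e; case.
have p1 : properIdeal (c 1).
  apply/properIdealP; split; first by apply: c_ideal; apply: ltn_trans m2.
  by move=> /c1.1; case/properIdealP: p2.
have /quasi_maximalP[_ /(_ _ p1 (properIdeal_sub0 p1))[e|M1]] := qm0.
  case: c0 => _; apply; rewrite e => _ ->.
  by have [] := c_ideal 0 (leq0n m).
by case: c1 => s12; rewrite (M1.2 _ p2 s12); case.
Qed.

End Quotient.

Theorem theorem2p3 (R : comNzRingType) (I : idealr R) :
  [<-> quasi_maximal [set` I] ;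
       forall J : set {ideal_quot I}, properIdeal J -> quasi_maximal J ;
       quasi_maximal [set 0 : {ideal_quot I}] ;
       (exists2 n : nat, has_length R {ideal_quot I} n & (1 <= n <= 2)%N) /\
       V [set 0 : {ideal_quot I}] #<= `I_2 ;
       PropIdl {ideal_quot I} #<= `I_3 /\
       (PropIdl {ideal_quot I} #= `I_3 <-> Max {ideal_quot I} #= `I_2) ;
       PropIdl_above [set` I] #<= `I_3 /\
       (PropIdl_above [set` I] #= `I_3 <->
        V [set` I] `&` Max R #= `I_2) ;
       (QiMax R `|` QrMax R `|` QdMax R) [set` I] ]
  /\ (quasi_maximal [set` I] -> V [set` I] `<=` Max R).
Proof.
have pI : properIdeal [set` I].
  by rewrite -preimage0; apply/preimage_properIdeal/properIdeal0.
have ePropIdl : PropIdl {ideal_quot I} = PropIdl_above [set 0].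
  by apply/seteqP; split=> [J pJ|J []//]; split=> //; apply: properIdeal_sub0.
have eMax : Max {ideal_quot I} = V [set 0] `&` Max _.
  apply/seteqP; split=> [J MJ|J []//]; split=> //; split; first exact: Max_Spec.
  exact: properIdeal_sub0 (Max_proper MJ).
split; last exact: quasi_maximal_V.
tfae.
- move=> /quasi_maximal_quotient qm0 J pJ.
  exact: quasi_maximal_over qm0 pJ (properIdeal_sub0 pJ).
- by apply; apply: properIdeal0.
- by move=> qm0; split; [apply/length_quasi_maximal | apply: quasi_maximal_card_V].
- move=> [/length_quasi_maximal qm0 _]; rewrite ePropIdl eMax.
  exact: quasi_maximal_card.
- rewrite ePropIdl eMax => -[le3 eq3].
  apply/quasi_maximal_card/quasi_maximal_quotient.
  exact: card_quasi_maximal (properIdeal0 _) le3 eq3.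
- by move=> [le3 eq3]; apply: quasi_maximal_trichotomy; apply: card_quasi_maximal.
exact: trichotomy_quasi_maximal.
Qed.
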